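(* Let $X$ be a real normed linear space, let $A\subset X$ be an open convex set, let $n\in\mathbb{N}$, and let $F\colon A\to\mathbb{R}^n$ and $g\colon\mathbb{R}^n\to\mathbb{R}$ be d.c. Then the composed function $g\circ F\colon A\to\mathbb{R}$ is d.c. on $A$.
   Context: A real function on a convex subset $C$ of a real normed linear space is called d.c. (delta-convex) if it is the difference of two continuous convex functions on $C$. A mapping $F\colon C\to\mathbb{R}^n$ is d.c. if each of its $n$ components is a d.c. function. *)

(* Defs.v *)
From HB Require Import structures.
From mathcomp Require Import all_boot all_order all_algebra.
From mathcomp Require Import all_classical all_reals all_analysis.

Set Implicit Arguments.
Unset Strict Implicit.
Unset Printing Implicit Defensive.

Import Order.TTheory GRing.Theory Num.Theory.
Import numFieldNormedType.Exports.

Local Open Scope classical_set_scope.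
Local Open Scope ring_scope.

(* A function on [C] is encoded as a total function on [V]: only its values on
   [C] matter. Convexity of [C] is left to the statements using these
   definitions. *)
Definition dc_function (R : realType) (V : normedModType R) (C : set V)
    (f : V -> R) : Prop :=
  exists f1 f2 : V -> R,
    [/\ {within C, continuous f1} /\ convex_function C f1,
        {within C, continuous f2} /\ convex_function C f2
      & forall x, C x -> f x = f1 x - f2 x].

Definition dc_mapping (R : realType) (V : normedModType R) (C : set V)
    (n : nat) (F : V -> 'rV[R]_n) : Prop :=
  forall i : 'I_n, dc_function C (fun x => F x ord0 i).

(* Main.v *)
Require Import Defs.
From HB Require Import structures.
From mathcomp Require Import all_boot all_order all_algebra.
From mathcomp Require Import all_classical all_reals all_analysis.
From mathcomp Require Import ring lra.
From mathcomp Require unstable.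

Set Implicit Arguments.
Unset Strict Implicit.
Unset Printing Implicit Defensive.

Import Order.TTheory GRing.Theory Num.Theory.
Import numFieldNormedType.Exports.

Local Open Scope classical_set_scope.
Local Open Scope ring_scope.

(* Writing g as a difference of convex functions, it suffices to treat a convex
   u. A continuous convex function on the open set A is bounded below by
   c - k |x - x0|, so the components of F are differences of nonnegative
   continuous convex functions; the sum f of all these functions is convex,
   dominates |F_i|, and controls F: the defect of F_i from affinity on a segment
   is at most the convexity defect of f. Take N convex and nondecreasing on the
   nonnegative reals such that N t bounds the slopes of u on the cube of
   half-side t. Then phi t = t N t grows at least as fast as the Lipschitz
   constant of u, so that both phi o f and u o F + phi o f are convex. *)

(** * Continuous convex functions on a set *)

Section convexity.
Context (R : realType) (V : normedModType R).
Implicit Types (C : set V) (f g : V -> R).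

(** Trades the weight in a bundled unit interval for two real weights with sum 1, a form suited to
    linear arithmetic. *)
Lemma convex_setP C : convex_set C <->
  forall x y (a b : R), 0 <= a -> 0 <= b -> a + b = 1 ->
    C x -> C y -> C (a *: x + b *: y).
Proof.
split=> [cC x y a b a0 b0 ab Cx Cy|cC x y t].
  have a1 : a <= 1 by lra.
  have /set_mem := cC x y (Itv01 a0 a1) (mem_set Cx) (mem_set Cy).
  by rewrite /conv/= /unstable.onem/= -ab addrAC subrr add0r.
rewrite !inE => Cx Cy; apply: cC => //; rewrite /unstable.onem/=.
- by rewrite subr_ge0.
- by rewrite addrC subrK.
Qed.

Lemma convex_functionP C f : convex_function C f <->
  forall x y (a b : R), 0 <= a -> 0 <= b -> a + b = 1 ->
    C x -> C y -> f (a *: x + b *: y) <= a * f x + b * f y.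
Proof.
split=> [cf x y a b a0 b0 ab Cx Cy|cf t x y].
  have a1 : a <= 1 by lra.
  have := cf (Itv01 a0 a1) x y (mem_set Cx) (mem_set Cy).
  by rewrite /conv/= /conv/= /unstable.onem/= -ab [a + b - a]addrAC subrr add0r.
rewrite !inE => Cx Cy; apply: cf => //; rewrite /unstable.onem/=.
- by rewrite subr_ge0.
- by rewrite addrC subrK.
Qed.

Definition continuous_convex C f :=
  {within C, continuous f} /\ convex_function C f.

Lemma continuous_convexD C f g : continuous_convex C f ->
  continuous_convex C g -> continuous_convex C (fun x => f x + g x).
Proof.
move=> [cf /convex_functionP vf] [cg /convex_functionP vg]; split.
  exact: within_continuousD cf cg.
apply/convex_functionP => x y a b a0 b0 ab Cx Cy.
by have := vf _ _ _ _ a0 b0 ab Cx Cy; have := vg _ _ _ _ a0 b0 ab Cx Cy; lra.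
Qed.

Lemma continuous_convex_cst C (k : R) : continuous_convex C (fun=> k).
Proof.
split; first by apply: continuous_subspaceT => x; exact: cvg_cst.
by apply/convex_functionP => x y a b _ _ ab _ _; rewrite -mulrDl ab mul1r.
Qed.

Lemma continuous_convex_sum C (I : Type) (s : seq I) (h : I -> V -> R) :
  (forall i, continuous_convex C (h i)) ->
  continuous_convex C (fun x => \sum_(i <- s) h i x).
Proof.
move=> ch; elim: s => [|i s ih].
  rewrite (_ : (fun=> _) = fun=> 0); first exact: continuous_convex_cst.
  by apply/funext => x; rewrite big_nil.
rewrite (_ : (fun=> _) = fun x => h i x + \sum_(j <- s) h j x).
  exact: continuous_convexD.
by apply/funext => x; rewrite big_cons.
Qed.

Lemma continuous_convex_dist C (k : R) (x0 : V) : 0 <= k ->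
  continuous_convex C (fun x => k * `|x - x0|).
Proof.
move=> k0; split.
  apply: continuous_subspaceT => x; apply: cvgMr; apply: cvg_norm.
  by apply: cvgB; [exact: cvg_id|exact: cvg_cst].
apply/convex_functionP => x y a b a0 b0 ab _ _.
rewrite (_ : a *: x + b *: y - x0 = a *: (x - x0) + b *: (y - x0)); last first.
  by rewrite !scalerBr addrACA -opprD -scalerDl ab scale1r.
have := ler_normD (a *: (x - x0)) (b *: (y - x0)).
rewrite !normrZ (ger0_norm a0) (ger0_norm b0) => /(ler_wpM2l k0).
by rewrite mulrDr !(mulrCA k).
Qed.

Lemma continuous_convex_pos C f : continuous_convex C f ->
  continuous_convex C (fun x => Num.max (f x) 0).
Proof.
move=> [cf /convex_functionP vf]; split.
  by move=> x; apply: continuous_max; [exact: cf|exact: cvg_cst].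
apply/convex_functionP => x y a b a0 b0 ab Cx Cy.
rewrite ge_max (le_trans (vf _ _ _ _ a0 b0 ab Cx Cy))/=.
  by rewrite addr_ge0// mulr_ge0// le_max lexx orbT.
by rewrite lerD// ler_wpM2l// le_max lexx.
Qed.

(* The minorant comes from reflecting x through x0 into a ball around x0 where
   f is at most f x0 + 1. *)
Lemma convex_minorant C f (x0 : V) : open C -> C x0 -> continuous_convex C f ->
  exists2 k, 0 <= k & forall x, C x -> f x0 - k * `|x - x0| <= f x.
Proof.
move=> oC Cx0 [+ /convex_functionP vf].
rewrite continuous_open_subspace// => /(_ x0 (mem_set Cx0)).
move=> /cvgrPdist_le/(_ 1 ltr01) /= f1.
have /nbhs_normP[r /= r0 rP] :
    \forall x \near x0, C x /\ `|f x0 - f x| <= 1.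
  by near=> x; split; near: x => //; exact: open_nbhs_nbhs.
(* The point [z] opposite to [x] will lie at distance exactly [s] from [x0], hence inside the open
   ball. As [f] rises by at most 1 over that distance, the slope is [s^-1]. *)
have [s s0 sr] : exists2 s, 0 < s & s < r by exists (r / 2); lra.
exists s^-1 => [|x Cx]; first by rewrite invr_ge0 ltW.
have [->|xx0] := eqVneq x x0; first by rewrite subrr normr0 mulr0 subr0.
set d := `|x - x0|; have d0 : 0 < d by rewrite normr_gt0 subr_eq0.
pose z := x0 - (s / d) *: (x - x0).
have [Cz fz] : C z /\ `|f x0 - f z| <= 1.
  apply: rP; rewrite /= /z opprB addrC subrK normrZ ger0_norm ?divr_ge0// ?ltW//.
  by rewrite -/d divfK ?gt_eqF.
have sd0 : s + d != 0 by rewrite gt_eqF// addr_gt0.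
have := vf x z (s / (s + d)) (d / (s + d)).
rewrite !divr_ge0 ?addr_ge0 ?(ltW s0) ?(ltW d0)// => /(_ isT isT).
rewrite -mulrDl divff// => /(_ erefl Cx Cz).
have -> : (s / (s + d)) *: x + (d / (s + d)) *: z = x0.
  rewrite /z scalerBr scalerA scalerBr.
  have -> : d / (s + d) * (s / d) = s / (s + d) by field; rewrite sd0 gt_eqF.
  rewrite opprB addrCA [X in _ + X]addrC subrK addrC -scalerDl.
  by rewrite -mulrDl divff// scale1r.
move=> H; have {}H : f x0 * (s + d) <= s * f x + d * f z.
  rewrite -ler_pdivlMr ?addr_gt0// (le_trans H)// le_eqVlt; apply/orP; left.
  by apply/eqP; field.
have : f z <= f x0 + 1 by move: fz; rewrite ler_norml => /andP[]; lra.
rewrite -(ler_pM2l d0) => H2.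
rewrite -(ler_pM2l s0) mulrBr mulrA divff ?gt_eqF// mul1r; lra.
Unshelve. all: by end_near. Qed.

End convexity.

(** * Nonnegative decompositions and control of d.c. mappings *)

Section dc_closure.
Context (R : realType) (V : normedModType R).
Implicit Types (C : set V) (f g : V -> R).

Lemma dc_functionB C f g :
  dc_function C f -> dc_function C g -> dc_function C (fun x => f x - g x).
Proof.
move=> [f1 [f2 [cf1 cf2 fE]]] [g1 [g2 [cg1 cg2 gE]]].
exists (fun x => f1 x + g2 x), (fun x => f2 x + g1 x); split.
- exact: (continuous_convexD cf1 cg2).
- exact: (continuous_convexD cf2 cg1).
- by move=> x Cx; rewrite fE// gE//; ring.
Qed.

(** Adding one cone [h] to both parts leaves their difference unchanged. Its slope [k1 + k2] and its
    constant term outweigh the minorants of both parts at once. *)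
Lemma dc_function_nonneg C f (x0 : V) : open C -> C x0 -> dc_function C f ->
  exists f1 f2 : V -> R,
    [/\ continuous_convex C f1, continuous_convex C f2,
        forall x, C x -> 0 <= f1 x, forall x, C x -> 0 <= f2 x &
        forall x, C x -> f x = f1 x - f2 x].
Proof.
move=> oC Cx0 [f1 [f2 [cf1 cf2 fE]]].
have [k1 k10 m1] := convex_minorant oC Cx0 cf1.
have [k2 k20 m2] := convex_minorant oC Cx0 cf2.
pose h x := (k1 + k2) * `|x - x0| + (`|f1 x0| + `|f2 x0|).
have ch : continuous_convex C h.
  apply: continuous_convexD; last exact: continuous_convex_cst.
  by apply: continuous_convex_dist; rewrite addr_ge0.
exists (fun x => f1 x + h x), (fun x => f2 x + h x); split.
- exact: continuous_convexD.
- exact: continuous_convexD.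
- move=> x Cx; have := m1 x Cx; have := mulr_ge0 k20 (normr_ge0 (x - x0)).
  by have := lerNnormlW (lexx `|f1 x0|); have := normr_ge0 (f2 x0);
    rewrite /h mulrDl; lra.
- move=> x Cx; have := m2 x Cx; have := mulr_ge0 k10 (normr_ge0 (x - x0)).
  by have := lerNnormlW (lexx `|f2 x0|); have := normr_ge0 (f1 x0);
    rewrite /h mulrDl; lra.
- by move=> x Cx; rewrite fE//; ring.
Qed.

(* The last condition says that both f + F_i and f - F_i are convex. *)
Lemma dc_mapping_control C n (F : V -> 'rV[R]_n) (x0 : V) :
    open C -> C x0 -> dc_mapping C F ->
  exists f : V -> R, [/\ continuous_convex C f,
    forall x i, C x -> `|F x ord0 i| <= f x,
    (forall x, C x -> 0 <= f x) &
    forall x y (a b : R) i, 0 <= a -> 0 <= b -> a + b = 1 -> C x -> C y ->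
      C (a *: x + b *: y) ->
      `|F (a *: x + b *: y) ord0 i - (a * F x ord0 i + b * F y ord0 i)|
        <= a * f x + b * f y - f (a *: x + b *: y)].
Proof.
move=> oC Cx0 dF.
have /choice[p pP] : forall i, exists p : (V -> R) * (V -> R),
    [/\ continuous_convex C p.1, continuous_convex C p.2,
        forall x, C x -> 0 <= p.1 x, forall x, C x -> 0 <= p.2 x &
        forall x, C x -> F x ord0 i = p.1 x - p.2 x].
  by move=> i; have [f1 [f2 H]] := dc_function_nonneg oC Cx0 (dF i);
    exists (f1, f2).
pose h i x := (p i).1 x + (p i).2 x.
have ch i : continuous_convex C (h i).
  by have [p1 p2 _ _ _] := pP i; exact: continuous_convexD.
have h0 i x : C x -> 0 <= h i x.
  by have [_ _ p1 p2 _] := pP i => Cx; rewrite addr_ge0 ?p1 ?p2.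
exists (fun x => \sum_i h i x); split.
- exact: continuous_convex_sum.
- move=> x i Cx; rewrite (bigD1 i)//= ler_wpDr//.
    by apply: sumr_ge0 => j _; exact: h0.
  have [_ _ /(_ x Cx) p1 /(_ x Cx) p2 ->//] := pP i.
  by rewrite ler_norml /h; apply/andP; split; lra.
- by move=> x Cx; apply: sumr_ge0 => i _; exact: h0.
- move=> x y a b i a0 b0 ab Cx Cy Cz.
  (* The convexity defect of the sum is the sum of the defects of the [h j]. All are nonnegative, so
     the one of index [i] suffices. *)
  rewrite !mulr_sumr -big_split -sumrB/= (bigD1 i)//= ler_wpDr//.
    apply: sumr_ge0 => j _; rewrite subr_ge0.
    by have [_ /convex_functionP] := ch j; apply.
  have [[_ /convex_functionP c1] [_ /convex_functionP c2] _ _ pE] := pP i.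
  have := c1 _ _ _ _ a0 b0 ab Cx Cy; have := c2 _ _ _ _ a0 b0 ab Cx Cy.
  by rewrite !pE// ler_norml /h => *; apply/andP; split; lra.
Qed.

End dc_closure.

(** * Growth of convex functions *)

Section growth.
Context (R : realType) (V : normedModType R).

(** The point [s *: w] is a convex combination of [t *: w] and 0, with weight [s / t <= 1] on the
    former. *)
Lemma convex_zero_ray (v : V -> R) (w : V) (s t : R) :
    convex_function setT v -> (forall x, 0 <= v x) -> v 0 = 0 ->
  0 <= s <= t -> v (s *: w) <= v (t *: w).
Proof.
move=> /convex_functionP cv v0 v00 /andP[s0 st].
have [->|sn0] := eqVneq s 0; first by rewrite scale0r v00.
have t0 : 0 < t by rewrite (lt_le_trans _ st)// lt_neqAle eq_sym sn0.
have st1 : s / t <= 1 by rewrite ler_pdivrMr// mul1r.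
have := cv (t *: w) 0 (s / t) (1 - s / t).
rewrite subr_ge0 st1 divr_ge0 ?(ltW t0)// => /(_ isT isT).
rewrite addrC subrK => /(_ erefl I I).
rewrite scaler0 addr0 scalerA divfK ?gt_eqF// v00 mulr0 addr0 => /le_trans; apply.
by rewrite ler_piMl.
Qed.

(** A sum is the midpoint of its doubled head and its doubled tail, so each induction step costs one
    factor 2 inside [v]. The factor [2^-1] gained outside is dropped, as [v] is nonnegative; the
    crude constant is good enough. *)
Lemma convex_zero_sum (v : V -> R) (T : Type) (s : seq T) (G : T -> V) :
    convex_function setT v -> (forall x, 0 <= v x) -> v 0 = 0 ->
  v (\sum_(i <- s) G i) <= \sum_(i <- s) v ((2 ^+ size s) *: G i).
Proof.
move=> cv v0 v00; elim: s G => [|j s ih] G; first by rewrite !big_nil v00.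
rewrite !big_cons /=.
have := (convex_functionP _ _).1 cv (2 *: G j) (2 *: \sum_(i <- s) G i) 2^-1 2^-1.
rewrite invr_ge0 ler0n => /(_ isT isT).
have -> : 2^-1 + 2^-1 = 1 :> R by lra.
rewrite !scalerA mulVf ?pnatr_eq0// !scale1r => /(_ erefl I I) /le_trans; apply.
have half x : 2^-1 * v x <= v x by rewrite ler_piMl// invf_le1 ?ler1n.
apply: lerD; apply: (le_trans (half _)).
  apply: convex_zero_ray => //; rewrite ler0n/= exprS ler_peMr//.
  exact: exprn_ege1 (ler1n _ 2).
rewrite scaler_sumr (le_trans (ih _))//.
by apply: ler_sum => i _; rewrite scalerA exprSr.
Qed.

(** The argument of [u] is affine in [t]. This makes the growth bound below convex in the size of
    the cube. *)
Lemma continuous_convex_line (u : V -> R) (k : R) (w : V) :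
  continuous_convex setT u ->
  @continuous_convex R R^o setT (fun t => u ((k * (t + 1)) *: w)).
Proof.
move=> [cu /convex_functionP vu]; split.
  apply: continuous_subspaceT => t; apply: continuous_comp; last first.
    exact: ((continuous_subspace_setT _).2 cu).
  apply: cvgZr_tmp; apply: cvgMr; apply: cvgD; first exact: cvg_id.
  exact: cvg_cst.
apply/(@convex_functionP R R^o) => s t a b a0 b0 ab _ _.
rewrite (_ : _ *: w = a *: ((k * (s + 1)) *: w) + b *: ((k * (t + 1)) *: w)).
  exact: vu.
rewrite !scalerA -scalerDl; congr (_ *: _).
rewrite (_ : a *: s + b *: t + 1 = a * (s + 1) + b * (t + 1)); first by ring.
by rewrite -[X in _ + X = _]ab /GRing.scale/=; ring.
Qed.

(** Slopes increase along the line from [x] through [y] to the point [y + d^-1 *: (y - x)], because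
    [y] divides that segment in the ratio [d : 1]. When [y - x] has size at most [d], the far point
    stays within distance 1 of [y]. *)
Lemma convex_extrapolate (u : V -> R) (x y : V) (d : R) :
    convex_function setT u -> 0 < d ->
  u y - u x <= d * (u (y + d^-1 *: (y - x)) - u y).
Proof.
move=> /convex_functionP cu d0; set z := y + _.
have d1 : 0 < 1 + d by rewrite addr_gt0.
have := cu z x (d / (1 + d)) (1 / (1 + d)).
rewrite !divr_ge0 ?(ltW d1) ?(ltW d0)// => /(_ isT isT).
rewrite -mulrDl [d + 1]addrC divff ?gt_eqF// => /(_ erefl I I).
rewrite (_ : _ *: z + _ = y) => [H|].
  have {}H : u y * (1 + d) <= d * u z + u x.
    rewrite -ler_pdivlMr// (le_trans H)// le_eqVlt; apply/orP; left.
    by apply/eqP; field; rewrite gt_eqF.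
  by move: H; lra.
rewrite /z scalerDr scalerA mulrAC divff ?gt_eqF// scalerBr -addrA.
rewrite subrK -scalerDl -mulrDl [d + 1]addrC divff ?gt_eqF//.
by rewrite scale1r.
Qed.

End growth.

Lemma convex_rV_growth (R : realType) (n : nat) (u : 'rV[R]_n -> R) :
    continuous_convex setT u ->
  exists N : R -> R, [/\ @continuous_convex R R^o setT N,
    forall t, 0 <= N t,
    forall s t, 0 <= s <= t -> N s <= N t &
    forall t (y z : 'rV[R]_n), 0 <= t -> (forall i, `|y ord0 i| <= t) ->
      (forall i, `|z ord0 i| <= t + 1) -> u z - u y <= N t].
Proof.
move=> cu.
(* Normalizing [u] to be nonnegative and zero at the origin makes the ray and sum estimates
   available. *)
pose v x := Num.max (u x - u 0) 0.
have cv : continuous_convex setT v.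
  apply: continuous_convex_pos; apply: continuous_convexD => //.
  exact: continuous_convex_cst.
have v0 x : 0 <= v x by rewrite le_max lexx orbT.
have v00 : v 0 = 0 by rewrite /v subrr maxxx.
have uv x : u x - u 0 <= v x by rewrite le_max lexx.
have ray := convex_zero_ray _ cv.2 v0 v00.
pose e (i : 'I_n) : 'rV[R]_n := delta_mx 0 i.
(* u is bounded on the cube by its values at the points +-(c t) e_i *)
pose c : R := 2 ^+ size (index_enum 'I_n).
have c0 : 0 <= c by rewrite exprn_ge0.
(* Negative multiples of [e i] are read as nonnegative multiples of [- e i], to which [ray]
   applies. *)
have cE i a : (- c * a) *: e i = (c * a) *: - e i.
  by rewrite scalerN mulNr scaleNr.
pose M t := \sum_i (v ((c * t) *: e i) + v ((- c * t) *: e i)).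
have vM t (x : 'rV[R]_n) : (forall i, `|x ord0 i| <= t) -> v x <= M t.
  move=> xt; rewrite [x]row_sum_delta.
  rewrite (le_trans (convex_zero_sum _ _ cv.2 v0 v00))//.
  apply: ler_sum => i _; rewrite scalerA -/c.
  have := xt i; rewrite ler_norml => /andP[x1 x2].
  have [xi0|xi0] := leP 0 (x ord0 i).
    by rewrite ler_wpDr// ray// mulr_ge0//= ler_wpM2l.
  rewrite ler_wpDl// -[x ord0 i]opprK mulrN -mulNr !cE ray//.
  by rewrite mulr_ge0 ?oppr_ge0 ?(ltW xi0)//= ler_wpM2l// lerNl.
have M0 t : 0 <= M t by rewrite sumr_ge0// => i _; rewrite addr_ge0.
have cM : @continuous_convex R R^o setT (fun t => M (t + 1)).
  apply: (@continuous_convex_sum R R^o) => i.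
  by apply: (@continuous_convexD R R^o); exact: continuous_convex_line.
(* One copy bounds [u z - u 0], the other [u 0 - u y]. *)
exists (fun t => M (t + 1) + M (t + 1)); split.
- exact: (@continuous_convexD R R^o).
- by move=> t; rewrite addr_ge0.
- move=> s t /andP[s0 st].
  suff : M (s + 1) <= M (t + 1) by lra.
  apply: ler_sum => i _.
  have H w : v ((c * (s + 1)) *: w) <= v ((c * (t + 1)) *: w).
    by rewrite ray// mulr_ge0 ?addr_ge0//= ler_wpM2l// lerD2r.
  by rewrite lerD// !cE.
- move=> t y z t0 yt zt.
  have Hz := vM _ _ zt.
  have Hy : v (- y) <= M (t + 1).
    by apply: vM => i; rewrite mxE normrN (le_trans (yt i))// ler_wpDr.
  (* The origin is the midpoint of [y] and [- y], so [u 0 - u y <= u (- y) - u 0]: an upper bound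
     for [v] also limits how far [u] can drop. *)
  have := (convex_functionP _ _).1 cu.2 y (- y) 2^-1 2^-1.
  rewrite invr_ge0 ler0n => /(_ isT isT).
  have -> : 2^-1 + 2^-1 = 1 :> R by lra.
  move=> /(_ erefl I I); rewrite scalerN subrr.
  by have := uv z; have := uv (- y); lra.
Qed.

(** * Composition of a d.c. mapping with a d.c. function *)

Lemma rV_within_continuous (R : realType) (T : topologicalType) (A : set T)
    (n : nat) (F : T -> 'rV[R]_n) :
  (forall i, {within A, continuous (fun x => F x ord0 i)}) ->
  {within A, continuous F}.
Proof.
move=> cF x; apply/cvgrPdist_le => /= e e0.
near=> y.
rewrite /Num.Def.normr/= mx_normrE (bigmax_le _ (ltW e0))//= => -[i j] _ /=.
rewrite !mxE (ord1 i)/=.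
move: j {i}; near: y; apply: filter_forall => /= j.
exact: ((cvgrPdist_le _ _).1 (cF j x)).
Unshelve. all: by end_near. Qed.

Lemma dc_comp_convex (R : realType) (X : normedModType R) (A : set X)
    (n : nat) (F : X -> 'rV[R]_n) (u : 'rV[R]_n -> R) :
    open A -> convex_set A -> dc_mapping A F -> continuous_convex setT u ->
  dc_function A (u \o F).
Proof.
move=> oA /convex_setP vA dF cu.
(* The control function is built around a base point of [A], so the empty set is treated apart. *)
have [[x0 Ax0]|A0] := pselect (exists x, A x); last first.
  have -> : A = set0 by apply/seteqP; split=> // x Ax; case: A0; exists x.
  by exists (u \o F), (fun=> 0); split=> //; split=> //;
    do ?exact: continuous_subspace0; move=> t x y; rewrite inE.
have [f [cf Ff f0 fd]] := dc_mapping_control oA Ax0 dF.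
have [N [cN N0 Nmono NP]] := convex_rV_growth cu.
have cF : {within A, continuous F}.
  apply: rV_within_continuous => i.
  have [f1 [f2 [[c1 _] [c2 _] fE]]] := dF i.
  apply: (@subspace_eq_continuous _ A _ (fun x => f1 x - f2 x)).
    by move=> x /set_mem /fE.
  exact: within_continuousB.
have cuF : {within A, continuous (u \o F)}.
  apply: within_continuous_comp cF => x _.
  exact: ((continuous_subspace_setT _).2 cu.1).
have cfN : {within A, continuous (fun x => f x * N (f x))}.
  have cNf : {within A, continuous (N \o f)}.
    apply: within_continuous_comp cf.1 => x _.
    exact: ((continuous_subspace_setT _).2 cN.1).
  by move=> x; apply: cvgM; [exact: cf.1|exact: cNf].
(* A quantitative convexity: where [f] has defect [d] at the intermediate point [z], the function
   [f * (N \o f)] has defect at least [d * N (f z)]. This surplus will absorb the failure of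
   [u \o F] to be convex. *)
have vfN x y (a b : R) : 0 <= a -> 0 <= b -> a + b = 1 -> A x -> A y ->
    f (a *: x + b *: y) * N (f (a *: x + b *: y)) +
    (a * f x + b * f y - f (a *: x + b *: y)) * N (f (a *: x + b *: y)) <=
    a * (f x * N (f x)) + b * (f y * N (f y)).
  move=> a0 b0 ab Ax Ay; set z := a *: x + b *: y.
  have fz : f z <= a * f x + b * f y.
    exact: ((convex_functionP _ _).1 cf.2 _ _ _ _ a0 b0 ab Ax Ay).
  have Nz : N (f z) <= a * N (f x) + b * N (f y).
    apply: (@le_trans _ _ (N (a * f x + b * f y))).
      by rewrite Nmono// fz f0//; exact: vA.
    exact: ((@convex_functionP R R^o _ _).1 cN.2 _ _ _ _ a0 b0 ab I I).
  rewrite -mulrDl addrC subrK.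
  (* Chebyshev's inequality, as f and N o f are similarly ordered *)
  apply: (le_trans (ler_wpM2l _ Nz)).
    by rewrite addr_ge0// mulr_ge0// f0.
  suff : 0 <= a * b * ((f x - f y) * (N (f x) - N (f y))).
    have -> : b = 1 - a by lra.
    by lra.
  apply: mulr_ge0; first exact: mulr_ge0.
  have [fxy|/ltW fxy] := leP (f x) (f y).
    by rewrite mulr_le0// subr_le0// Nmono// fxy f0.
  by rewrite mulr_ge0// subr_ge0// Nmono// fxy f0.
exists (fun x => u (F x) + f x * N (f x)), (fun x => f x * N (f x)); split.
- split; first exact: within_continuousD cuF cfN.
  apply/convex_functionP => x y a b a0 b0 ab Ax Ay.
  have := vfN _ _ _ _ a0 b0 ab Ax Ay.
  have Az : A (a *: x + b *: y) by exact: vA.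
  have {}fd i := fd x y a b i a0 b0 ab Ax Ay Az.
  have fz := (convex_functionP _ _).1 cf.2 _ _ _ _ a0 b0 ab Ax Ay.
  set z := a *: x + b *: y in Az fd fz *.
  set d := a * f x + b * f y - f z in fd *.
  have d0 : 0 <= d by rewrite subr_ge0.
  have cuy := (convex_functionP _ _).1 cu.2 (F x) (F y) _ _ a0 b0 ab I I.
  set w := a *: F x + b *: F y in cuy.
  (* Convexity of [u] handles the affine interpolation [w]; what is left is the cost of moving from
     [w] to [F z]. *)
  suff : u (F z) - u w <= d * N (f z) by lra.
  have fdE i : F z ord0 i - (a * F x ord0 i + b * F y ord0 i) = (F z - w) ord0 i.
    by rewrite !mxE.
  (* The extrapolation divides by [d]. If [d] vanishes, [F] has no defect either and [F z = w]. *)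
  have [d00|dn0] := eqVneq d 0.
    have -> : F z = w.
      apply/rowP => i; apply/eqP; rewrite -subr_eq0 -normr_eq0 eq_le normr_ge0.
      by have := fd i; rewrite fdE d00 !mxE andbT.
    by rewrite subrr d00 mul0r.
  have {dn0}dp : 0 < d by rewrite lt_neqAle eq_sym dn0.
  apply: (le_trans (convex_extrapolate _ _ cu.2 dp)).
  (* [F z] lies in the cube of half-side [f z]. The entries of [d^-1 *: (F z - w)] are at most 1 in
     absolute value, so the extrapolated point lies in the cube of half-side [f z + 1]. *)
  apply: (ler_wpM2l d0); apply: NP; [exact: f0|by move=> i; exact: Ff|move=> i].
  rewrite mxE (le_trans (ler_normD _ _))// lerD ?Ff//.
  by rewrite mxE -fdE normrM gtr0_norm ?invr_gt0// ler_pdivrMl// mulr1.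
- split=> //; apply/convex_functionP => x y a b a0 b0 ab Ax Ay.
  rewrite (le_trans _ (vfN _ _ _ _ a0 b0 ab Ax Ay))// ler_wpDr// mulr_ge0//.
  by rewrite subr_ge0; exact: ((convex_functionP _ _).1 cf.2 _ _ _ _ a0 b0 ab Ax Ay).
- by move=> x _ /=; rewrite addrK.
Qed.

Theorem theorem4p1 (R : realType) (X : normedModType R) (A : set X)
    (openA : open A) (convexA : convex_set A) (n : nat)
    (F : X -> 'rV[R]_n) (g : 'rV[R]_n -> R)
    (dcF : dc_mapping A F) (dcg : dc_function setT g) :
  dc_function A (g \o F).
Proof.
have [u [v [cu cv gE]]] := dcg.
rewrite (_ : g \o F = fun x => (u \o F) x - (v \o F) x); last first.
  by apply/funext => x /=; exact: gE.
by apply: dc_functionB; exact: dc_comp_convex.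
Qed.
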